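(* For every non-negative integer $n$: $$R_{0,3}(n)=\begin{cases}\dfrac{\bar{O}_2(n)}{2}+\dfrac{(-1)^{\frac{m(3m\mp1)}{2}}}{2} & \text{if } n=\frac{m(3m\pm1)}{2},\\[2mm] 0 & \text{otherwise,}\end{cases}$$ and $$R_{1,3}(n)=\begin{cases}\dfrac{\bar{O}_2(n)}{2}-\dfrac{(-1)^{\frac{m(3m\mp1)}{2}}}{2} & \text{if } n=\frac{m(3m\pm1)}{2},\\[2mm] 0 & \text{otherwise.}\end{cases}$$ Here $m$ is a non-negative integer and signs correspond: if $n=\frac{m(3m+1)}{2}$ the exponent of $-1$ is $\frac{m(3m-1)}{2}$, and if $n=\frac{m(3m-1)}{2}$ the exponent is $\frac{m(3m+1)}{2}$.
   Context: A 3-color partition of $n$ is a finite multiset of positive integers (parts), each carrying one of the colors $color(1),color(2),color(3)$, whose sum is $n$. $\mathcal{R}_3(n)$ is the set of 3-color partitions of $n$ in which even parts occur only in $color(2)$ and $color(3)$ and in which parts of the same color do not repeat (equal integers in different colors are allowed). $R_{0,3}(n)$ (resp. $R_{1,3}(n)$) is the number of partitions in $\mathcal{R}_3(n)$ in which the number of parts in $color(3)$ is even (resp. odd). $\bar{O}_2(n)$ is the number of partitions of $n$ into odd parts, each carrying one of two colors $color(1),color(2)$, in which parts of $color(2)$ may be overlined in the sense of overpartitions (for each part size, the first occurrence of that size in $color(2)$ may or may not be overlined). Thus $\sum_{n\ge0}\bar{O}_2(n)q^n=\prod_{j\ge1}\frac{1+q^{2j-1}}{(1-q^{2j-1})^2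}$.
   Formalization: The ''0 otherwise'' branches are false (for n = 3 the single part 3 in color(1) already gives R_{0,3}(3) ≥ 1); for n not of the form m(3m±1)/2 the formal statement gives both R_{0,3}(n) and R_{1,3}(n) the value Ō_2(n)/2 instead. *)

(* Defs.v *)
From mathcomp Require Import all_boot.

Set Implicit Arguments.
Unset Strict Implicit.
Unset Printing Implicit Defensive.

(* A k-color partition of n is encoded by its multiplicity function:
   l (c, i) is the number of copies of the part i.+1 in color(c.+1).
   A multiset of positive integers with sum n has all its parts and all its
   multiplicities bounded by n, so these finite functions cover all of them. *)
Definition multiplicities (k n : nat) : finType :=
  {ffun 'I_k * 'I_n -> 'I_n.+1}.

Definition color_partition (k n : nat) (l : multiplicities k n) : bool :=
  \sum_(c < k) \sum_(i < n) l (c, i) * i.+1 == n.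

Definition color1 {k : nat} : 'I_k.+1 := ord0.
Definition color2 {k : nat} : 'I_k.+2 := lift ord0 ord0.
Definition color3 {k : nat} : 'I_k.+3 := lift ord0 (lift ord0 ord0).

Definition nb_parts (k n : nat) (l : multiplicities k n) (c : 'I_k) : nat :=
  \sum_(i < n) l (c, i).

Definition R3 (n : nat) : {set multiplicities 3 n} :=
  [set l : multiplicities 3 n |
    [&& color_partition l,
        [forall c : 'I_3, forall i : 'I_n,
           (0 < l (c, i)) && ~~ odd i.+1 ==> (c \in [:: color2; color3])]
      & [forall c : 'I_3, forall i : 'I_n, l (c, i) <= 1]]].

Definition R03 (n : nat) : nat :=
  #|[set l in R3 n | ~~ odd (nb_parts l color3)]|.

Definition R13 (n : nat) : nat :=
  #|[set l in R3 n | odd (nb_parts l color3)]|.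

(* The overlining is recorded by the set S of part sizes whose first occurrence
   in color(2) is overlined (i in S stands for the size i.+1); such a size has
   to occur in color(2). *)
Definition O2bar (n : nat) : nat :=
  #|[set lS : multiplicities 2 n * {set 'I_n} |
      [&& color_partition lS.1,
          [forall c : 'I_2, forall i : 'I_n, (0 < lS.1 (c, i)) ==> odd i.+1]
        & lS.2 \subset [set i | 0 < lS.1 (color2, i)]]]|.

(* For m = 0 the truncated 3 * m - 1 is harmless because of the factor m; both
   products are always even, so the halves are exact. *)
Definition pent_plus (m : nat) : nat := (m * (3 * m + 1)) %/ 2.
Definition pent_minus (m : nat) : nat := (m * (3 * m - 1)) %/ 2.

(* Main.v *)
(* Let (a; q) denote the product of the 1 - a q^k over k >= 0. The generating
   function of R_3(n) with a weight s for each part in color(3) is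
   (-q; q^2) (-q; q) (-s q; q). For s = 1 Euler's identity (-q; q) (q; q^2) = 1
   turns it into (-q; q^2) / (q; q^2)^2, the generating function of O2bar. For
   s = -1 it becomes (-q; q^2) (q^2; q^2), which is (q; q) with q replaced by
   -q, so that Euler's pentagonal number theorem applies. Hence R03 + R13 and
   R03 - R13 are known. Power series are replaced by polynomials modulo
   X^(n+1). *)
Require Import Defs.
From mathcomp Require Import all_boot all_order all_algebra.
From mathcomp Require Import ring lra zify.

Local Open Scope ring_scope.
Import GRing.Theory.

(** * Pentagonal numbers and Shanks' identity *)

(** This division-free form is the exponent [s * n + 'C(s.+1, 2)] of Shanks' sum at [s = n = m]. *)
Lemma pent_plusE (m : nat) : (pent_plus m = m * m + 'C(m.+1, 2))%N.
Proof.
rewrite /pent_plus -(mulKn (m * m + _) (isT : 0 < 2)%N); congr (_ %/ _)%N.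
by have := mul_bin_diag m.+1 1; rewrite bin1 /=; lia.
Qed.

Lemma pent_minusE (m : nat) : (pent_minus m + m = pent_plus m)%N.
Proof.
rewrite /pent_plus /pent_minus addnC -divnMDl //; congr (_ %/ _)%N.
by case: m => [|m] //; lia.
Qed.

(* Shanks' finite form of Euler's pentagonal number theorem: the term s = 0 is
   (1 - q)...(1 - q^n) and every other term is divisible by q^(n+1). *)
Lemma shanks_identity (R : comNzRingType) (q : R) (n : nat) :
  \sum_(0 <= s < n.+1) (-1) ^+ s * q ^+ (s * n + 'C(s.+1, 2)) *
     \prod_(s.+1 <= i < n.+1) (1 - q ^+ i)
  = 1 + \sum_(1 <= m < n.+1)
          (-1) ^+ m * (q ^+ pent_plus m + q ^+ pent_minus m).
Proof.
elim: n => [|n IHn].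
  by rewrite big_nat1 !big_geq // !mulr1 addr0.
rewrite [in RHS]big_nat_recr //= addrA -IHn.
rewrite big_nat_recr //= [in X in _ + X = _]big_geq // mulr1.
(* The increment of the left-hand side in n telescopes along a. *)
pose a s := (-1) ^+ s * q ^+ (s * n + 'C(s.+1, 2)) *
  \prod_(s <= i < n.+1) (1 - q ^+ i).
have a0 : a 0%N = 0 by rewrite /a big_nat_recl // expr0 subrr mul0r mulr0.
have aS : a n.+1 = (-1) ^+ n.+1 * q ^+ pent_minus n.+1.
  rewrite /a big_geq // mulr1; congr (_ * q ^+ _).
  by apply/eqP; rewrite -(eqn_add2r n.+1) pent_minusE pent_plusE; lia.
(* The new term [s = n.+1] on the left is the [pent_plus] term. The increments of the other terms
   have to add up to [a n.+1], the [pent_minus] term. *)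
rewrite -pent_plusE mulrDr [RHS]addrCA [RHS]addrC; congr (_ + _).
rewrite -aS -(subr0 (a n.+1)) -[in X in _ - X]a0 -telescope_sumr // -big_split /=.
apply: eq_big_nat => s /andP[_ lt_sn]; rewrite /a.
rewrite [\prod_(s.+1 <= i < n.+2) _]big_nat_recr //=.
rewrite [\prod_(s <= i < n.+1) _]big_ltn //.
have -> : (s * n.+1 + 'C(s.+1, 2) = s * n + 'C(s.+1, 2) + s)%N by lia.
have -> : (s.+1 * n + 'C(s.+2, 2) = s * n + 'C(s.+1, 2) + s + n.+1)%N.
  by rewrite binS bin1; lia.
rewrite !exprD !exprS; ring.
Qed.

(** * Congruence of polynomials modulo X^N *)

Definition eqmodXn (N : nat) (p r : {poly rat}) := 'X^N %| p - r.

Lemma eqmodXn_refl N p : eqmodXn N p p.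
Proof. by rewrite /eqmodXn subrr dvdp0. Qed.

Lemma eqmodXn_sym N p r : eqmodXn N p r -> eqmodXn N r p.
Proof. by rewrite /eqmodXn -opprB dvdpNr. Qed.

Lemma eqmodXn_trans N p r s :
  eqmodXn N p r -> eqmodXn N r s -> eqmodXn N p s.
Proof. by move=> pr rs; rewrite /eqmodXn -(subrKA r); apply: dvdp_add. Qed.

Lemma eqmodXnM N p1 r1 p2 r2 :
  eqmodXn N p1 r1 -> eqmodXn N p2 r2 -> eqmodXn N (p1 * p2) (r1 * r2).
Proof.
move=> pr1 pr2; rewrite /eqmodXn.
have -> : p1 * p2 - r1 * r2 = (p1 - r1) * p2 + r1 * (p2 - r2) by ring.
by apply: dvdp_add; [apply: dvdp_mulr | apply: dvdp_mull].
Qed.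

Lemma eqmodXn_prod N (I : eqType) (s : seq I) (P : pred I) (F G : I -> {poly rat}) :
  (forall i, i \in s -> P i -> eqmodXn N (F i) (G i)) ->
  eqmodXn N (\prod_(i <- s | P i) F i) (\prod_(i <- s | P i) G i).
Proof.
move=> FG; rewrite big_seq_cond [X in eqmodXn _ _ X]big_seq_cond.
apply: (big_ind2 (eqmodXn N)) => [|????|i /andP[]]; last exact: FG.
- exact: eqmodXn_refl.
- exact: eqmodXnM.
Qed.

Lemma eqmodXn_coef N p r i : (i < N)%N -> eqmodXn N p r -> p`_i = r`_i.
Proof.
move=> lt_iN /dvdpP[u /(canRL (subrK _)) ->].
by rewrite coefD coefMXn lt_iN add0r.
Qed.

Lemma eqmodXn_addXn N p c j : (N <= j)%N -> eqmodXn N (p + c * 'X^j) p.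
Proof.
by move=> le_Nj; rewrite /eqmodXn addrC addKr dvdp_mull // dvdp_exp2l.
Qed.

(** A polynomial with nonzero constant term is coprime to ['X^N]. *)
Lemma eqmodXn_cancel N u p r :
  ~~ root u 0 -> eqmodXn N (u * p) (u * r) -> eqmodXn N p r.
Proof.
move=> u0; rewrite /eqmodXn -mulrBr Gauss_dvdpr //.
by rewrite coprimep_expl // coprimep_sym coprimepX.
Qed.

(* The extra factors 1 - X^k with n < k <= 2n are 1 modulo X^(n+1). *)
Lemma prod_even_eqmod n :
  eqmodXn n.+1 (\prod_(1 <= k < n.+1) (1 - 'X^(k.*2)))
               (\prod_(1 <= k < n.+1 | ~~ odd k) (1 - 'X^k)).
Proof.
have -> : \prod_(1 <= k < n.+1) (1 - 'X^(k.*2)) =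
          \prod_(1 <= k < n.*2.+1 | ~~ odd k) (1 - 'X^k) :> {poly rat}.
  elim: n => [|n IHn]; first by rewrite !big_geq.
  rewrite doubleS big_nat_recr //= IHn; rewrite [RHS]big_mkcond /=.
  rewrite [RHS]big_nat_recr //= [in RHS]big_nat_recr //=.
  by rewrite odd_double /= mulr1 -big_mkcond.
rewrite (@big_cat_nat _ _ _ n.+1) //=; last by rewrite ltnS -addnn leq_addr.
rewrite -[X in eqmodXn _ _ X]mulr1; apply: eqmodXnM; first exact: eqmodXn_refl.
apply: (eqmodXn_trans _ _ (\prod_(n.+1 <= k < n.*2.+1 | ~~ odd k) 1)).
  2: by rewrite big1_eq eqmodXn_refl.
apply: eqmodXn_prod => k; rewrite mem_index_iota => /andP[lt_nk _] _.
by rewrite -mulN1r eqmodXn_addXn.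
Qed.

(** * Generating functions of R_3 and of O2bar *)

(** Expanding the product picks one exponent per factor. With [J] the pairs of a color and a part
    size, [f] is a multiplicity function and the coefficient is a weighted count of color
    partitions. *)
Lemma coef_prod_sum (R : comNzRingType) (J : finType) (N : nat)
    (w : J -> nat) (c : J -> 'I_N.+1 -> R) (m : nat) :
  (\prod_j \sum_(a < N.+1) c j a *: 'X^(a * w j))`_m =
  \sum_(f : {ffun J -> 'I_N.+1} | (\sum_j f j * w j)%N == m) \prod_j c j (f j).
Proof.
rewrite bigA_distr_bigA coef_sum [RHS]big_mkcond /=; apply: eq_bigr => f _.
rewrite scaler_prod prodrXr /= coefZ coefXn eq_sym.
by case: eqP => _; rewrite ?mulr1 ?mulr0.
Qed.

Lemma prodr_bool (R : comNzRingType) (J : finType) (b : pred J) :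
  \prod_j (b j)%:R = [forall j, b j]%:R :> R.
Proof.
have [/forallP b1|/forallPn[j /negPf bj]] := boolP [forall j, b j].
  by rewrite big1 // => j _; rewrite b1.
by rewrite (bigD1 j) //= bj mul0r.
Qed.

Lemma prodr_pair_if (R : comNzRingType) (I J : finType) (d : I)
    (F : I * J -> R) :
  \prod_(p : I * J) (if p.1 == d then F p else 1) = \prod_j F (d, j).
Proof.
rewrite -big_mkcond /= (reindex_onto (pair d) snd) /=; last first.
  by move=> [i j] /= /eqP->.
by apply: eq_bigl => j; rewrite !eqxx.
Qed.

Lemma prod_iotaS_pair (R : comNzRingType) (d n : nat)
    (G : 'I_d -> nat -> R) :
  \prod_(p : 'I_d * 'I_n) G p.1 p.2.+1 =
  \prod_(1 <= k < n.+1) \prod_(c < d) G c k.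
Proof.
rewrite big_add1 /= big_mkord exchange_big /=.
by rewrite (pair_bigA _ (fun (c : 'I_d) (i : 'I_n) => G c i.+1)).
Qed.

Lemma color_partitionE (k n : nat) (l : multiplicities k n) :
  color_partition l = (\sum_p l p * p.2.+1 == n)%N.
Proof.
rewrite /color_partition.
rewrite (pair_bigA _ (fun (c : 'I_k) (i : 'I_n) => l (c, i) * i.+1)%N) /=.
by rewrite [in RHS](eq_bigr (fun p => l (p.1, p.2) * p.2.+1)%N) => [|[c i]].
Qed.

Lemma sum_multiplicity_le1 (n k : nat) (g : nat -> rat) : (0 < n)%N ->
  g 0%N = 1 -> (forall a, (1 < a)%N -> g a = 0) ->
  \sum_(a < n.+1) g a *: 'X^(a * k) = 1 + g 1%N *: 'X^k.
Proof.
case: n => // n _ g0 g_gt1; rewrite !big_ord_recl /= big1 => [|i _].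
  by rewrite g0 mul0n expr0 scale1r mul1n addr0.
by rewrite g_gt1 // scale0r.
Qed.

Lemma coef_prod_R3 (n : nat) (s : rat) :
  (\prod_(1 <= k < n.+1)
     ((if odd k then 1 + 'X^k else 1) * (1 + 'X^k) * (1 + s *: 'X^k)))`_n =
  \sum_(l in R3 n) s ^+ nb_parts l color3.
Proof.
(* [b] tests whether multiplicity [a] is allowed for part [k] in color [c]. The product of the [g]
   is thus [s ^+ nb_parts l color3] if [l] meets the conditions of [R3] on colors and repetition,
   and 0 otherwise. *)
pose b (c : 'I_3) (k a : nat) := (a <= 1)%N &&
  ((0 < a)%N && ~~ odd k ==> (c \in [:: color2; color3])).
pose g (c : 'I_3) k a : rat := (b c k a)%:R * (if c == color3 then s ^+ a else 1).
transitivity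
  (\prod_(p : 'I_3 * 'I_n) \sum_(a < n.+1) g p.1 p.2.+1 a *: 'X^(a * p.2.+1))`_n.
  congr (polyseq _)`_n; rewrite (prod_iotaS_pair _ _ _
    (fun c k => \sum_(a < n.+1) g c k a *: 'X^(a * k))).
  apply: eq_big_nat => k /andP[k_gt0 lt_kn].
  have n_gt0 : (0 < n)%N by apply: leq_trans k_gt0 _.
  have g0 c : g c k 0%N = 1 by rewrite /g /b mul1r expr0 if_same.
  have g_gt1 c a : (1 < a)%N -> g c k a = 0.
    by case: a => [|[|a]] // _; rewrite /g /b mul0r.
  under eq_bigr => c _ do
    rewrite (sum_multiplicity_le1 _ _ _ n_gt0 (g0 c) (g_gt1 c)).
  rewrite !big_ord_recl big_ord0 mulr1 mulrA /g /b /= !inE /=.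
  by case: (odd k); rewrite /= ?mul1r ?mul0r ?scale1r ?scale0r ?addr0 ?expr1 ?mul1r.
rewrite coef_prod_sum big_mkcond [RHS]big_mkcond; apply: eq_bigr => l _.
rewrite inE color_partitionE; case: eqP => //= _.
rewrite /g big_split /= prodr_bool prodr_pair_if prodrXr.
rewrite [X in if X then _ else _](_ : _ =
  [forall p : 'I_3 * 'I_n, b p.1 p.2.+1 (l p)]).
  by case: ifP; rewrite ?mul1r ?mul0r.
apply/andP/forallP => [[/forallP H1 /forallP H2] [c i]|H].
  by rewrite /b /= (forallP (H2 c)) (forallP (H1 c)).
by split; apply/forallP => c; apply/forallP => i; case/andP: (H (c, i)).
Qed.

(** The weight 2 of a positive multiplicity in color(2) counts the choice to overline or not: the
    sets [S] that go with [l] form the power set of its color(2) support. *)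
Lemma coef_prod_O2bar (n : nat) :
  (\prod_(1 <= k < n.+1)
     (if odd k then
        (\sum_(a < n.+1) 'X^(a * k)) *
        (\sum_(a < n.+1) (if (0 < a)%N then 2 else 1) *: 'X^(a * k))
      else 1))`_n = (O2bar n)%:R :> rat.
Proof.
pose b (k a : nat) := (0 < a)%N ==> odd k.
pose g (c : 'I_2) k a : rat :=
  (b k a)%:R * (if c == color2 then if (0 < a)%N then 2 else 1 else 1).
transitivity
  (\prod_(p : 'I_2 * 'I_n) \sum_(a < n.+1) g p.1 p.2.+1 a *: 'X^(a * p.2.+1))`_n.
  congr (polyseq _)`_n; rewrite (prod_iotaS_pair _ _ _
    (fun c k => \sum_(a < n.+1) g c k a *: 'X^(a * k))).
  apply: eq_big_nat => k /andP[k_gt0 lt_kn].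
  case: (boolP (odd k)) => [k_odd|/negPf k_even].
    rewrite big_ord_recl big_ord_recl big_ord0 mulr1 /g /b k_odd.
    congr (_ * _); apply: eq_bigr => a _ /=; rewrite implybT mul1r //.
    by rewrite scale1r.
  rewrite big1 // => c _; rewrite big_ord_recl big1 => [|i _].
    by rewrite /g /b /= mul1r if_same scale1r addr0.
  by rewrite /g /b /= k_even mul0r scale0r.
rewrite coef_prod_sum /O2bar -sum1_card.
under eq_bigl => lS do rewrite inE andbA.
rewrite -(pair_big_dep
  (fun l : multiplicities 2 n => color_partition l &&
     [forall c, forall i : 'I_n, (0 < l (c, i))%N ==> odd i.+1])
  (fun l (S : {set 'I_n}) => S \subset [set i | (0 < l (color2, i))%N])
  (fun _ _ => 1%N)) /=.
rewrite natr_sum big_mkcond [RHS]big_mkcond; apply: eq_bigr => l _.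
rewrite color_partitionE; case: eqP => //= _.
rewrite /g big_split /= prodr_bool.
rewrite [X in if X then _ else _](_ : _ =
  [forall p : 'I_2 * 'I_n, b p.2.+1 (l p)]); last first.
  apply/forallP/forallP => [H [c i]|H c]; first exact: forallP (H c) i.
  by apply/forallP => i; apply: (H (c, i)).
case: ifP => _; rewrite ?mul0r // mul1r.
rewrite (prodr_pair_if _ _ _ _ (fun p => if (0 < l p)%N then 2 else 1)).
rewrite -big_mkcond /= prodr_const sum1_card -natrX; congr (_%:R).
rewrite -cardsE -card_powerset cardsE; apply: eq_card => S.
by rewrite !unfold_in.
Qed.

(** * Product identities modulo X^(n+1) *)

Lemma gf_R3_split (n : nat) (s : rat) :
  \prod_(1 <= k < n.+1)
     ((if odd k then 1 + 'X^k else 1) * (1 + 'X^k) * (1 + s *: 'X^k)) =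
  \prod_(1 <= k < n.+1 | odd k) (1 + 'X^k) * \prod_(1 <= k < n.+1) (1 + 'X^k) *
  \prod_(1 <= k < n.+1) (1 + s *: 'X^k).
Proof. by rewrite !big_split /= [in RHS]big_mkcond. Qed.

(** For odd [k], [1 + 'X^k] is [1 - (- 'X) ^+ k]. The even factors come from pairing [1 + 'X^k] with
    [1 - 'X^k] into [1 - 'X^(k.*2)]. *)
Lemma eqmodXn_gf_diff (n : nat) :
  eqmodXn n.+1
    (\prod_(1 <= k < n.+1 | odd k) (1 + 'X^k) *
     \prod_(1 <= k < n.+1) (1 + 'X^k) * \prod_(1 <= k < n.+1) (1 - 'X^k))
    (\prod_(1 <= k < n.+1) (1 - (- 'X) ^+ k)).
Proof.
rewrite -mulrA -big_split /= [X in eqmodXn _ _ X](bigID odd) /=.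
apply: eqmodXnM.
  rewrite (eq_bigr (fun k => 1 - (- 'X) ^+ k)) ?eqmodXn_refl // => k k_odd.
  by rewrite exprNn -signr_odd k_odd expr1 mulN1r opprK.
rewrite (eq_bigr (fun k => 1 - 'X^(k.*2))) => [|k _]; last first.
  by rewrite -addnn exprD; ring.
rewrite [X in eqmodXn _ _ X](eq_bigr (fun k => 1 - 'X^k)).
  exact: prod_even_eqmod.
by move=> k /negPf k_even; rewrite exprNn -signr_odd k_even mul1r.
Qed.

(* Truncation of Euler's identity (q; q^2) (-q; q) = 1. *)
Lemma prod_odd_eqmod (n : nat) :
  eqmodXn n.+1
    (\prod_(1 <= k < n.+1 | odd k) (1 - 'X^k) * \prod_(1 <= k < n.+1) (1 + 'X^k))
    1.
Proof.
(* Multiplied by [E], the left side becomes the product of all [1 - 'X^(k.*2)], which is congruent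
   to [E] itself; then [E] cancels. *)
pose E : {poly rat} := \prod_(1 <= k < n.+1 | ~~ odd k) (1 - 'X^k).
apply: (eqmodXn_cancel _ E).
  rewrite /E big_nat_cond; apply: (big_ind (fun p : {poly rat} => ~~ root p 0)).
  - by rewrite root1.
  - by move=> p r p0 r0; rewrite rootM negb_or p0.
  move=> k /andP[/andP[k_gt0 _] _].
  by rewrite rootE !hornerE expr0n eqn0Ngt k_gt0 subr0 oner_eq0.
rewrite mulr1 mulrA [E * _]mulrC -(bigID odd xpredT) /= -big_split /=.
rewrite (eq_bigr (fun k => 1 - 'X^(k.*2))) => [|k _]; last first.
  by rewrite -addnn exprD; ring.
exact: prod_even_eqmod.
Qed.

Lemma eqmodXn_geometric (n k : nat) : (0 < k)%N ->
  eqmodXn n.+1 ((1 - 'X^k) * \sum_(a < n.+1) 'X^(a * k)) 1.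
Proof.
move=> k_gt0; under eq_bigr => a _ do rewrite mulnC exprM.
rewrite -opprB mulNr -subrX1 opprB -exprM -mulN1r eqmodXn_addXn //.
by rewrite leq_pmull.
Qed.

(** This is 1 + 2x + 2x^2 + ... = 2/(1 - x) - 1 = (1 + x)/(1 - x) at x = X^k. *)
Lemma eqmodXn_overlined (n k : nat) : (0 < k)%N ->
  eqmodXn n.+1
    ((1 - 'X^k) *
     \sum_(a < n.+1) (if (0 < a)%N then 2 else 1) *: 'X^(a * k)) (1 + 'X^k).
Proof.
move=> k_gt0.
have -> : \sum_(a < n.+1) (if (0 < a)%N then 2 else 1) *: 'X^(a * k) =
          2 * (\sum_(a < n.+1) 'X^(a * k)) - 1 :> {poly rat}.
  rewrite !big_ord_recl /= mul0n expr0 scale1r mulrDr mulr1.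
  rewrite (eq_bigr (fun i : 'I_n => 2 * 'X^(lift ord0 i * k))) => [|i _].
    by rewrite -mulr_sumr; ring.
  by rewrite scaler_nat mulr_natl.
have /dvdpP[u uE] := eqmodXn_geometric n k k_gt0.
(* With G the geometric sum and x = X^k, (1 - x)(2G - 1) - (1 + x) is twice (1 - x)G - 1. *)
apply/dvdpP; exists (2 * u).
rewrite -mulrA -uE; ring.
Qed.

Lemma eqmodXn_gf_sum (n : nat) :
  eqmodXn n.+1
    (\prod_(1 <= k < n.+1 | odd k) (1 + 'X^k) *
     \prod_(1 <= k < n.+1) (1 + 'X^k) * \prod_(1 <= k < n.+1) (1 + 'X^k))
    (\prod_(1 <= k < n.+1)
     (if odd k then
        (\sum_(a < n.+1) 'X^(a * k)) *
        (\sum_(a < n.+1) (if (0 < a)%N then 2 else 1) *: 'X^(a * k))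
      else 1)).
Proof.
rewrite -big_mkcond /=.
set A := \prod_(_ <= _ < _ | _) (1 + _); set P := \prod_(_ <= _ < _) _.
set G := \prod_(_ <= _ < _ | _) _.
(* [O] is inverse to [P], and [O * O] clears the denominators of [G], leaving [A]. Hence [A * P * P]
   is congruent to [O * P * (O * P) * G], that is, to [G]. *)
pose O : {poly rat} := \prod_(1 <= k < n.+1 | odd k) (1 - 'X^k).
have OP1 : eqmodXn n.+1 (O * P) 1 by apply: prod_odd_eqmod.
have OOG : eqmodXn n.+1 (O * O * G) A.
  rewrite /O /G -!big_split /=; apply: eqmodXn_prod => k.
  rewrite mem_index_iota => /andP[k_gt0 _] _.
  rewrite mulrACA -[X in eqmodXn _ _ X]mul1r.
  by apply: eqmodXnM; [apply: eqmodXn_geometric | apply: eqmodXn_overlined].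
apply: (eqmodXn_trans _ _ (O * O * G * (P * P))).
  rewrite -mulrA; apply: eqmodXnM; last exact: eqmodXn_refl.
  exact: eqmodXn_sym.
have -> : O * O * G * (P * P) = O * P * (O * P) * G by ring.
rewrite -[X in eqmodXn _ _ X]mul1r -[X in eqmodXn _ _ (X * _)]mul1r.
by do 2?[apply: eqmodXnM => //]; apply: eqmodXn_refl.
Qed.

Lemma eqmodXn_pentagonal (n : nat) :
  eqmodXn n.+1 (\prod_(1 <= k < n.+1) (1 - (- 'X) ^+ k))
    (1 + \sum_(1 <= m < n.+1)
       (-1) ^+ m * ((- 'X) ^+ pent_plus m + (- 'X) ^+ pent_minus m)).
Proof.
rewrite -shanks_identity [X in eqmodXn _ _ X]big_ltn //.
rewrite mul0n expr0 mul1r bin_small // expr0 mul1r.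
apply: eqmodXn_sym; rewrite /eqmodXn addrC addKr big_nat.
apply: (big_ind (fun p => 'X^(n.+1) %| p)) => [|p r|s /andP[s_gt0 _]].
- exact: dvdp0.
- exact: dvdp_add.
apply: dvdp_mulr; apply: dvdp_mull; rewrite exprNn; apply: dvdp_mull.
rewrite dvdp_exp2l // -addn1 leq_add //.
  by rewrite leq_pmull.
by rewrite bin_gt0.
Qed.

(** * The coefficients of the pentagonal series *)

(** [pent_minus j] equals [j * j + 'C(j, 2)], and ['C(i.+1, 2) <= 'C(j, 2)]. This ensures that [n]
    is pentagonal for at most one index [m]. *)
Lemma pent_plus_lt_minus (i j : nat) : (i < j)%N -> (pent_plus i < pent_minus j)%N.
Proof.
move=> lt_ij; rewrite -(ltn_add2r j) pent_minusE !pent_plusE.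
have := leq_bin2l 2 lt_ij; rewrite (binS j 1) bin1; nia.
Qed.

Lemma sum_pent (n m : nat) : (0 < m)%N -> n = pent_plus m \/ n = pent_minus m ->
  \sum_(1 <= i < n.+1)
     (-1) ^+ i * ((-1) ^+ n * ((n == pent_plus i)%:R + (n == pent_minus i)%:R))
  = (-1) ^+ (m + n) :> rat.
Proof.
move=> m_gt0 nE; have mE := pent_minusE m.
have mp := pent_plus_lt_minus 0 m m_gt0.
(* The sum reaches the index [m], since [m.-1 <= pent_plus m.-1 < pent_minus m <= n]. *)
have le_mn : (m < n.+1)%N.
  by move: (pent_plusE m) (pent_plusE m.-1) (pent_plus_lt_minus m.-1 m); nia.
rewrite (bigD1_seq m) ?mem_index_iota ?m_gt0 ?iota_uniq //=.
rewrite [X in _ + X]big_seq_cond [X in _ + X]big1 => [|i /andP[_ ne_im]].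
  rewrite addr0 mulrA -exprD -[RHS]mulr1; congr (_ * _).
  have ne : (pent_plus m == pent_minus m) = false by lia.
  by case: nE => ->; rewrite eqxx ?ne 1?eq_sym ?ne ?addr0 ?add0r.
have iE := pent_minusE i.
have [-> ->] : (n == pent_plus i) = false /\ (n == pent_minus i) = false.
  by case: (ltngtP i m) ne_im => // /pent_plus_lt_minus lt _; split; lia.
by rewrite addr0 !mulr0.
Qed.

(** * Sum and difference of R03 and R13 *)

(** The hypothesis holds for [s = 1] and [s = -1], which yield the sum and the difference. *)
Lemma R3_even_odd (n : nat) (s : rat) :
  (forall k, s ^+ k = (~~ odd k)%:R + s * (odd k)%:R) ->
  \sum_(l in R3 n) s ^+ nb_parts l color3 = (R03 n)%:R + s * (R13 n)%:R.
Proof.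
move=> sE; under eq_bigr => l _ do rewrite sE.
rewrite big_split /= -mulr_sumr /R03 /R13 -!sum1_card.
by congr (_ + _ * _); rewrite natr_sum (eq_bigl _ _ (in_set _)) big_mkcondr /=;
  apply: eq_bigr => l _; case: ifP.
Qed.

Lemma R03_addE (n : nat) : (R03 n)%:R + (R13 n)%:R = (O2bar n)%:R :> rat.
Proof.
rewrite -[(R13 n)%:R]mul1r -R3_even_odd => [|k]; last first.
  by rewrite expr1n; case: odd; rewrite ?addr0 ?add0r.
rewrite -coef_prod_R3 -coef_prod_O2bar gf_R3_split.
under [\prod_(1 <= k < n.+1) (1 + 1 *: _)]eq_bigr => k _ do rewrite scale1r.
exact: eqmodXn_coef (ltnSn n) (eqmodXn_gf_sum n).
Qed.

(** The sign [(-1) ^+ n] comes from substituting [- 'X] in the pentagonal series, and [n == 0] from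
    its constant term. *)
Lemma R03_subE (n : nat) :
  (R03 n)%:R - (R13 n)%:R = (n == 0%N)%:R + \sum_(1 <= i < n.+1)
     (-1) ^+ i * ((-1) ^+ n * ((n == pent_plus i)%:R + (n == pent_minus i)%:R))
  :> rat.
Proof.
rewrite -mulN1r -R3_even_odd => [|k]; last first.
  by rewrite -signr_odd; case: odd; rewrite ?addr0 ?add0r.
rewrite -coef_prod_R3 gf_R3_split.
under [\prod_(1 <= k < n.+1) (1 + -1 *: _)]eq_bigr => k _ do rewrite scaleN1r.
rewrite (eqmodXn_coef _ _ _ _ (ltnSn n) (eqmodXn_gf_diff n)).
rewrite (eqmodXn_coef _ _ _ _ (ltnSn n) (eqmodXn_pentagonal n)).
rewrite coefD coef1 coef_sum; congr (_ + _); apply: eq_bigr => i _.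
have coefNX j : ((- 'X) ^+ j : {poly rat})`_n = (-1) ^+ n * (n == j)%:R.
  by rewrite -scaleN1r exprZn coefZ coefXn; case: eqP => [->|_]; rewrite ?mulr0.
rewrite [X in _ = _ * X]mulrDr -!coefNX -(signr_odd _ i) -(signr_odd rat i).
by case: odd; rewrite !(expr1, expr0, mulN1r, mul1r) ?coefN coefD.
Qed.

Lemma R03_subE_pent (n m : nat) : n = pent_plus m \/ n = pent_minus m ->
  (R03 n)%:R - (R13 n)%:R = (-1) ^+ (m + n) :> rat.
Proof.
move=> nE; rewrite R03_subE; case: (posnP m) nE => [->|m_gt0] nE.
  (* The index [m = 0] gives only the constant term: the sum starts at 1. *)
  have -> : n = 0%N by case: nE => ->.
  by rewrite big_geq // addr0.
have := pent_plus_lt_minus 0 m m_gt0; have := pent_minusE m => mE mp.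
by rewrite (sum_pent n m) // [n == _]gtn_eqF ?add0r //; case: nE; lia.
Qed.

Lemma R03_subE_nonpent (n : nat) :
  (forall m, n <> pent_plus m /\ n <> pent_minus m) ->
  (R03 n)%:R - (R13 n)%:R = 0 :> rat.
Proof.
move=> nE; rewrite R03_subE big1 => [|i _].
  by have [n0|] := eqVneq n 0%N; [case: (nE 0%N); rewrite n0 | rewrite addr0].
by have [/eqP/negPf-> /eqP/negPf->] := nE i; rewrite addr0 !mulr0.
Qed.

Theorem theorem1p9 (n : nat) :
  [/\ forall m : nat, n = pent_plus m ->
        (R03 n)%:R = (O2bar n)%:R / 2%:R + (-1) ^+ pent_minus m / 2%:R :> rat,
      forall m : nat, n = pent_minus m ->
        (R03 n)%:R = (O2bar n)%:R / 2%:R + (-1) ^+ pent_plus m / 2%:R :> rat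
    & (forall m : nat, n <> pent_plus m /\ n <> pent_minus m) ->
        (R03 n)%:R = (O2bar n)%:R / 2%:R :> rat]
  /\
  [/\ forall m : nat, n = pent_plus m ->
        (R13 n)%:R = (O2bar n)%:R / 2%:R - (-1) ^+ pent_minus m / 2%:R :> rat,
      forall m : nat, n = pent_minus m ->
        (R13 n)%:R = (O2bar n)%:R / 2%:R - (-1) ^+ pent_plus m / 2%:R :> rat
    & (forall m : nat, n <> pent_plus m /\ n <> pent_minus m) ->
        (R13 n)%:R = (O2bar n)%:R / 2%:R :> rat].
Proof.
(* The exponents cross over because [pent_plus m = pent_minus m + m]: the sign exponent [m + n] is
   [pent_minus m + 2 * m] for [n = pent_plus m], and [pent_plus m] for [n = pent_minus m]. *)
have Hplus m : n = pent_plus m ->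
    (R03 n)%:R - (R13 n)%:R = (-1) ^+ pent_minus m :> rat.
  move=> nE; rewrite (R03_subE_pent n m); last by left.
  by rewrite nE -pent_minusE addnCA exprD addnn -muln2 exprM sqrr_sign mulr1.
have Hminus m : n = pent_minus m ->
    (R03 n)%:R - (R13 n)%:R = (-1) ^+ pent_plus m :> rat.
  move=> nE; rewrite (R03_subE_pent n m); last by right.
  by rewrite nE -pent_minusE addnC.
have add := R03_addE n; have H0 := R03_subE_nonpent n.
split; split=> [m /Hplus|m /Hminus|/H0]; lra.
Qed.
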